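(* Let $n,k\in\mathbb{N}$ and let $\lambda=(\lambda_1,\dots,\lambda_{kn})$ be a partition whose depth is at most $kn$. Then the monomial symmetric function $m_\lambda(x)$ in the variables $x=(x_1,\dots,x_{kn})$ has the expression $$m_\lambda(x)=\frac1{\operatorname{wrdet}_k V_{n,k}(x)}\sum_{\sigma\in\mathfrak{S}_{kn}/\mathfrak{S}_\lambda}D_{n,k}\Bigl(x;\boldsymbol{\delta}_{n,k}+\sum_{i=1}^{kn}\lambda_{\sigma(i)}\boldsymbol{e}_i\Bigr),$$ where the sum is over representatives $\sigma$ of the cosets $\mathfrak{S}_\lambda\sigma$ in $\mathfrak{S}_{kn}$.
   Context: $\mathfrak{S}_N$ is the symmetric group of degree $N$ and $\nu_N(w)$ is the number of cycles of $w\in\mathfrak{S}_N$ (fixed points included). For an $N\times N$ matrix $B=(b_{ij})$ with entries in a commutative $\mathbb{C}$-algebra, $\det_k B:=\sum_{w\in\mathfrak{S}_N}(-\tfrac1k)^{N-\nu_N(w)}b_{w(1)1}\cdots b_{w(N)N}$. For a matrix $A$ with $n$ columns, $A^{[k]}$ is obtained by repeating each column $k$ times consecutively, and for a $kn\times n$ matrix $A$, $\operatorname{wrdet}_k A:=\det_k(A^{[k]})$. $V_{n,k}(x)=(x_i^{n-j})_{1\le i\le kn,1\le j\le n}$. For $\boldsymbol{a}=(a_1,\dots,a_{kn})\in\mathbb{Z}_{\ge0}^{kn}$, $D_{n,k}(x;\boldsymbol{a})=\det_k(x_i^{a_j})_{1\le i,j\le kn}$. $\boldsymbol{e}_i\in\mathbb{Z}_{\ge0}^{kn}$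 is the $i$-th standard basis vector and $\boldsymbol{\delta}_{n,k}=\sum_{j=1}^{kn}\bigl(n-1-\lfloor\frac{j-1}k\rfloor\bigr)\boldsymbol{e}_j$. $\mathfrak{S}_\lambda=\{\sigma\in\mathfrak{S}_{kn}:\lambda_{\sigma(i)}=\lambda_i,\ 1\le i\le kn\}$, and $m_\lambda(x)=\sum_{\sigma}\prod_{i=1}^{kn}x_i^{\lambda_{\sigma(i)}}$, the sum being over representatives $\sigma$ of the cosets $\mathfrak{S}_\lambda\sigma$ (i.e. each distinct monomial occurs once). *)

(* Defs.v *)
From HB Require Import structures.
From mathcomp Require Export all_boot all_order all_fingroup all_algebra.
From mathcomp Require Export fraction reals complex mpoly.

Set Implicit Arguments.
Unset Strict Implicit.
Unset Printing Implicit Defensive.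

Import GRing.Theory.

Local Open Scope ring_scope.

(* [#|porbits w|] counts fixed points as cycles. *)
Definition kdet (F : fieldType) (A : comAlgType F) (k N : nat)
    (B : 'M[A]_N) : A :=
  \sum_(w : 'S_N)
    (- k%:R^-1 : F) ^+ (N - #|porbits w|) *: \prod_(j < N) B (w j) j.

Lemma ltn_ord_div (k n : nat) (j : 'I_(k * n)) : (j %/ k < n)%N.
Proof.
have lt_j : (j < k * n)%N := ltn_ord j.
have /andP[k_gt0 _] : (0 < k)%N && (0 < n)%N.
  by rewrite -muln_gt0 (leq_ltn_trans _ lt_j).
by rewrite ltn_divLR // (leq_trans lt_j) ?(mulnC k).
Qed.

Definition ord_div (k n : nat) (j : 'I_(k * n)) : 'I_n :=
  Ordinal (ltn_ord_div j).

Definition colrep (T : Type) (k p n : nat) (M : 'M[T]_(p, n)) :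
    'M[T]_(p, k * n) :=
  \matrix_(i, j) M i (ord_div j).

Definition wrdet (F : fieldType) (A : comAlgType F) (k n : nat)
    (M : 'M[A]_(k * n, n)) : A :=
  kdet k (colrep k M).

(* Columns are indexed from 0, hence the exponent [n - j.+1] for x_i^(n-j). *)
Definition rect_vandermonde (F : fieldType) (n k : nat) :
    'M[{mpoly F[k * n]}]_(k * n, n) :=
  \matrix_(i, j) 'X_i ^+ (n - j.+1).

Definition Dnk (F : fieldType) (n k : nat) (a : 'X_{1..k * n}) :
    {mpoly F[k * n]} :=
  kdet k (\matrix_(i < k * n, j < k * n) ('X_i ^+ a j : {mpoly F[k * n]})).

Definition delta_nk (n k : nat) : 'X_{1..k * n} :=
  (\sum_(j < k * n) (U_(j) *+ (n - 1 - j %/ k)))%MM.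

Definition part_stab (N : nat) (lam : N.-tuple nat) : {set 'S_N} :=
  [set s : 'S_N | [forall i, tnth lam (s i) == tnth lam i]].

Lemma part_stab_group_set (N : nat) (lam : N.-tuple nat) :
  group_set (part_stab lam).
Proof.
apply/group_setP; split=> [|s t].
  by rewrite inE; apply/forallP => i; rewrite perm1.
rewrite !inE => /forallP hs /forallP ht; apply/forallP => i.
by rewrite permM (eqP (ht _)) (eqP (hs _)).
Qed.

Canonical part_stab_group (N : nat) (lam : N.-tuple nat) :=
  Group (part_stab_group_set lam).

(* Since [(s * t) i = t (s i)], the left coset [s *: part_stab lam] is the set
   of composites t \o s with t in [part_stab lam], i.e. a right coset for the
   usual composition of permutations; i |-> lam_(s i) is constant on it. *)
Definition stab_cosets (N : nat) (lam : N.-tuple nat) : {set {set 'S_N}} :=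
  lcosets (part_stab lam) [set: 'S_N].

Definition mono_sym (F : fieldType) (N : nat) (lam : N.-tuple nat) :
    {mpoly F[N]} :=
  \sum_(s in transversal (stab_cosets lam) [set: 'S_N])
    \prod_(i < N) 'X_i ^+ tnth lam (s i).

(* Main.v *)
Require Import Defs.
From mathcomp Require Import zify.

(** Let [N = k * n], [c w = (- 1 / k) ^+ (N - #|porbits w|)], and let [d] be the
    exponent [delta_nk n k].  The k-determinant of a matrix of monomials
    x_i^(a_j) is the sum over [w] of [c w] times the monomial whose exponent
    is [a] rearranged by [w^-1] ([kdet_monomials]).  Since this rearrangement
    is additive in [a], the terms for [d + lam \o s] factor as the term for
    [d] times the monomial of [lam \o s \o w^-1].  For a fixed [w], composing
    with [w^-1] permutes the cosets of the stabilizer of [lam], so summing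
    over a transversal gives the monomial symmetric function whatever [w] is
    ([mono_sym_translate]).  Hence the sum of the [Dnk] is the product of
    [mono_sym] and [Dnk d], and [Dnk d] is the wreath determinant of the
    rectangular Vandermonde matrix ([wrdet_mul_mono_sym]).

    What remains is to divide, that is, to see that [Dnk d] is a nonzero
    polynomial.  Its coefficient at the monomial of exponent [d] is the sum of
    [c w] over the [w] that preserve [d], i.e. over the Young subgroup of
    [n] blocks of size [k].  Inserting the points one after another, each new
    point being either fixed or spliced into an existing cycle of its own
    block, shows that this sum is a product of factors [1 - m / k], with [m]
    the number of points already present in the block
    ([label_cycle_sumU1]).  As [m < k], no factor vanishes. *)

Set Implicit Arguments.
Unset Strict Implicit.
Unset Printing Implicit Defensive.

Import GRing.Theory Num.Theory.

Local Open Scope ring_scope.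

(** * Sums over transversals of left cosets *)

Lemma sum_transversal_lcosets (gT : finGroupType) (V : nmodType)
    (G : {group gT}) (F : gT -> V) (X : {set gT}) :
    (forall x h, h \in G -> F (x * h)%g = F x) ->
    is_transversal X (lcosets G [set: gT]) [set: gT] ->
  \sum_(x in X) F x = \sum_(C in lcosets G [set: gT]) F (repr C).
Proof.
move=> F_coset trX; rewrite -{1}(pblock_transversal trX) big_imset /=; last first.
  exact: pblock_inj trX.
apply: eq_bigr => x Xx; set B := pblock _ x.
have /and3P[/eqP covP _ _] : partition (lcosets G [set: gT]) [set: gT].
  by case/and3P: trX.
have Px : x \in cover (lcosets G [set: gT]) by rewrite covP inE.
have Bx : x \in B by rewrite mem_pblock.
have /lcosetsP[y _ defB] : B \in lcosets G [set: gT] by rewrite pblock_mem.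
have FB z : z \in B -> F z = F y.
  by rewrite defB => /lcosetP[h Gh ->]; apply: F_coset.
by rewrite (FB x Bx) FB // (mem_repr _ Bx).
Qed.

(** Left multiplication by [u] permutes the left cosets of [G], and the sum of a
    function that is constant on them depends on the cosets alone. *)
Lemma sum_transversal_translate (gT : finGroupType) (V : nmodType)
    (G : {group gT}) (F : gT -> V) (X Y : {set gT}) (u : gT) :
    (forall x h, h \in G -> F (x * h)%g = F x) ->
    is_transversal X (lcosets G [set: gT]) [set: gT] ->
    is_transversal Y (lcosets G [set: gT]) [set: gT] ->
  \sum_(x in X) F (u * x)%g = \sum_(y in Y) F y.
Proof.
move=> F_coset trX trY; rewrite [RHS](sum_transversal_lcosets F_coset trY).
rewrite (@sum_transversal_lcosets _ _ G (fun x => F (u * x)%g)) //; last first.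
  by move=> x h Gh; rewrite mulgA F_coset.
rewrite [RHS](reindex_inj (@lcoset_inj _ u)) /=.
have trans (v : gT) (C : {set gT}) :
    C \in lcosets G [set: gT] -> (v *: C)%g \in lcosets G [set: gT].
  case/lcosetsP=> y _ ->; apply/lcosetsP.
  by exists (v * y)%g; rewrite ?inE // lcosetM.
apply: eq_big => [C|_ /lcosetsP[y _ ->]].
  by apply/idP/idP => [/trans//|/(trans u^-1%g)]; rewrite lcosetK.
rewrite -lcosetM.
have FB z x : x \in (z *: G)%g -> F x = F z.
  by case/lcosetP=> h Gh ->; apply: F_coset.
rewrite (FB (u * y)%g (repr _)); last exact: mem_repr (lcoset_refl _ _).
apply: FB; rewrite lcosetM mem_lcoset mulKg.
exact: mem_repr (lcoset_refl _ _).
Qed.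

(** * Counting label-preserving permutations by cycles *)

Section LabelPreserving.

Variables (T : finType) (L : eqType) (f : T -> L).

(** With [A] the full set, these [s] form the Young subgroup attached to the level
    sets of [f]; restricting the support to [A] makes induction on [A]
    possible. *)
Definition label_perm (A : {set T}) (s : {perm T}) : bool :=
  perm_on A s && [forall i, f (s i) == f i].

(** A permutation [w] supported in [a |: A] factors uniquely as
    [tperm a b * s] with [s] fixing [a]: the point [b] must be the preimage of
    [a] under [w].  Multiplying by the transposition keeps labels exactly when
    [a] and [b] carry the same one. *)
Lemma label_perm_tperm (A : {set T}) (a b : T) (s : {perm T}) :
    a \notin A -> b \in a |: A -> f b = f a ->
  label_perm (a |: A) (tperm a b * s) && ((tperm a b * s)^-1%g a == b)
    = label_perm A s.
Proof.
move=> aNA bA fba.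
have ft i : f (tperm a b i) = f i by case: tpermP => // ->.
have t_on : perm_on (a |: A) (tperm a b).
  apply/subsetP=> i; rewrite inE; case: tpermP => [->|->|]; rewrite ?eqxx //.
  by rewrite !inE eqxx.
apply/idP/idP => [/andP[/andP[ts_on /forallP ts_f] /eqP sab]|].
  have sa : s a = a.
    have := permKV (tperm a b * s)%g a.
    by rewrite sab permM tpermR.
  apply/andP; split.
    have s_on : perm_on (a |: A) s.
      by rewrite -(mulKg (tperm a b) s) tpermV perm_onM.
    apply/subsetP=> i si; have := subsetP s_on i si.
    by rewrite !inE => /orP[/eqP ia|//]; move: si; rewrite inE ia sa eqxx.
  apply/forallP => i.
  by have := ts_f (tperm a b i); rewrite permM tpermK ft.
case/andP=> s_on /forallP s_f.
have sa : s a = a by apply: out_perm s_on aNA.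
apply/andP; split; last first.
  by rewrite -(inj_eq (@perm_inj _ (tperm a b * s)%g)) permKV permM tpermR sa.
apply/andP; split; last first.
  by apply/forallP=> i; rewrite permM (eqP (s_f _)) ft.
apply: perm_onM => //; apply/subsetP=> i si.
by rewrite inE (subsetP s_on) ?orbT.
Qed.

Lemma card_porbits_le (s : {perm T}) : (#|porbits s| <= #|T|)%N.
Proof. exact: leq_imset_card. Qed.

(** When [a] is a fixed point, multiplying by [tperm a b] splices it into the
    cycle of [b], so one cycle disappears unless [b] is [a] itself. *)
Lemma porbits_tperm_fixed (a b : T) (s : {perm T}) :
  s a = a ->
  (#|T| - #|porbits (tperm a b * s)| = (#|T| - #|porbits s|) + (a != b))%N.
Proof.
move=> sa; have := porbits_mul_tperm s a b.
have -> : (a \notin porbit s b) = (a != b).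
  rewrite porbit_sym; congr negb; apply/porbitP/eqP => [[i ->]|->].
    by elim: i => [|i IHi]; rewrite ?perm1 // expgSr permM -IHi sa.
  by exists 0; rewrite perm1.
have := card_porbits_le (tperm a b * s); have := card_porbits_le s.
case: (a != b) => /=; lia.
Qed.

Variables (R : comNzRingType) (t : R).

Definition label_cycle_sum (A : {set T}) : R :=
  \sum_(s | label_perm A s) t ^+ (#|T| - #|porbits s|).

Lemma label_cycle_sum0 : label_cycle_sum set0 = 1.
Proof.
rewrite /label_cycle_sum (big_pred1 1%g) => [|s].
  have /eqP-> : #|porbits (1%g : {perm T})| == #|T|.
    rewrite card_imset // => x y /setP/(_ x).
    by rewrite porbit_id => /esym/porbitP[i ->]; rewrite expg1n perm1.
  by rewrite subnn.
apply/andP/eqP => [[s_on _]|->].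
  by apply/permP=> i; rewrite perm1 (out_perm s_on) ?inE.
by split; [exact: perm_on1 | apply/forallP=> i; rewrite perm1].
Qed.

(** The new point [a] is either left fixed, contributing [1], or inserted after
    one of the points of [A] with the same label, each contributing a factor
    [t] because the number of cycles drops by one relative to [s]. *)
Lemma label_cycle_sumU1 (A : {set T}) (a : T) :
    a \notin A ->
  label_cycle_sum (a |: A) =
    (1 + t *+ #|[set b in A | f b == f a]|) * label_cycle_sum A.
Proof.
move=> aNA; rewrite /label_cycle_sum.
rewrite (partition_big (fun s : {perm T} => s^-1%g a)
  (fun b => (b \in a |: A) && (f b == f a))) /=; last first.
  move=> s /andP[s_on /forallP s_f]; rewrite -(perm_closed _ s_on) permKV setU11.
  by have := s_f (s^-1%g a); rewrite permKV eq_sym.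
transitivity (\sum_(b | (b \in a |: A) && (f b == f a))
    t ^+ (a != b) * label_cycle_sum A).
  apply: eq_bigr => b /andP[bA /eqP fba].
  (* For a fixed preimage [b] of [a], substitute [tperm a b * s] for [s]. *)
  rewrite (reindex_inj (mulgI (tperm a b))) mulr_sumr.
  apply: eq_big => [s|s]; first exact: label_perm_tperm.
  rewrite label_perm_tperm // => /andP[s_on _].
  by rewrite porbits_tperm_fixed ?exprD 1?mulrC // (out_perm s_on).
rewrite -mulr_suml; congr (_ * _).
rewrite (bigD1 a) /= ?setU11 ?eqxx //; congr (_ + _).
rewrite -sumr_const; apply: eq_big => [b|b /andP[_ ba]].
  rewrite !inE; case: (eqVneq b a) => [->|]; rewrite ?andbF ?andbT //=.
  by rewrite (negPf aNA).
by rewrite eq_sym ba.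
Qed.

End LabelPreserving.

(** The factors produced by inserting the points of [A] are [1 - m / k], where [m]
    counts the earlier points with the same label; the point being inserted
    also belongs to that level set, so [m < k]. *)
Lemma label_cycle_sum_neq0 (F : numFieldType) (T : finType) (L : eqType)
    (f : T -> L) (k : nat) (A : {set T}) :
    (forall a, #|[set b in A | f b == f a]| <= k)%N ->
  label_cycle_sum f (- k%:R^-1 : F) A != 0.
Proof.
move: {-1}#|A| (erefl #|A|) => m.
elim: m A => [|m IHm] A cardA leA.
  by move/eqP: cardA; rewrite cards_eq0 => /eqP->; rewrite label_cycle_sum0 oner_neq0.
have [a Aa] : exists a, a \in A by apply/card_gt0P; rewrite cardA.
rewrite -(setD1K Aa) label_cycle_sumU1 ?setD11 // mulf_neq0 //; last first.
  apply: IHm => [|b]; first by move: cardA; rewrite (cardsD1 a) Aa => -[].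
  apply: leq_trans (leA b); apply/subset_leq_card/subsetP => c.
  by rewrite !inE -andbA => /and3P[_ -> ->].
set c := #|_|.
have ltck : (c < k)%N.
  apply: leq_trans (leA a); apply/proper_card/properP; split.
    by apply/subsetP=> b; rewrite !inE -andbA => /and3P[_ -> ->].
  by exists a; rewrite !inE ?Aa ?eqxx.
have k0 : k%:R != 0 :> F by rewrite pnatr_eq0 -lt0n (leq_ltn_trans _ ltck).
rewrite mulNrn subr_eq0; apply/eqP => /(congr1 ( *%R k%:R)) /eqP.
by rewrite mulr1 mulrnAr divff // eqr_nat gtn_eqF.
Qed.

(** * The k-determinant of a matrix of monomials *)

Lemma multinom_sumU (N : nat) (g : 'I_N -> nat) :
  (\sum_(i < N) U_(i) *+ g i)%MM = [multinom g i | i < N].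
Proof.
by rewrite [RHS]multinomUE_id; apply: eq_bigr => i _; rewrite mnmE.
Qed.

Lemma kdet_monomials (F : fieldType) (k N : nat) (a : 'X_{1..N}) :
  kdet k (\matrix_(i < N, j < N) ('X_i ^+ a j : {mpoly F[N]})) =
    \sum_(w : 'S_N) (- k%:R^-1 : F) ^+ (N - #|porbits w|) *:
      'X_[[multinom a (w^-1%g i) | i < N]].
Proof.
apply: eq_bigr => w _; congr (_ *: _); rewrite (mpolyXE _ w).
by apply: eq_bigr => j _; rewrite mxE mnmE permK.
Qed.

Lemma wrdet_vandermonde (F : fieldType) (n k : nat) :
  wrdet (rect_vandermonde F n k) = Dnk F (delta_nk n k).
Proof.
congr kdet; apply/matrixP => i j.
by rewrite !mxE /delta_nk multinom_sumU mnmE /= -subnDA add1n.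
Qed.

(** The monomial of exponent [delta_nk n k] is hit by [w] exactly when [w] preserves
    this exponent, which takes each value [k] times. *)
Lemma Dnk_delta_neq0 (F : numFieldType) (n k : nat) :
  Dnk F (delta_nk n k) != 0.
Proof.
set d := delta_nk n k.
have dE j : d j = (n - 1 - j %/ k)%N by rewrite /d /delta_nk multinom_sumU mnmE.
suff : (Dnk F d)@_d != 0 by apply: contraNneq => ->; rewrite mcoeff0.
have -> : (Dnk F d)@_d = label_cycle_sum d (- k%:R^-1 : F) [set: 'I_(k * n)].
  rewrite /Dnk kdet_monomials raddf_sum /label_cycle_sum /=.
  rewrite [RHS]big_mkcond [RHS](reindex_inj invg_inj) /=.
  apply: eq_bigr => w _.
  rewrite mcoeffZ mcoeffX porbitsV card_ord.
  have -> : ([multinom d (w^-1%g i) | i < k * n] == d) =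
      label_perm d [set: 'I_(k * n)] w^-1%g.
    rewrite /label_perm; have -> /= : perm_on [set: 'I_(k * n)] w^-1%g.
      by apply/subsetP=> i; rewrite inE.
    apply/eqP/forallP => [dw i|dw]; first by rewrite -{2}dw mnmE.
    by apply/mnmP => i; rewrite mnmE (eqP (dw i)).
  by case: ifP => _; rewrite ?mulr1 ?mulr0.
apply: label_cycle_sum_neq0 => a.
have k_gt0 : (0 < k)%N by case: k a {d dE} => // -[].
(* On a level set of [d] the quotient by [k] is constant, so the remainder
   embeds the level set in ['I_k]. *)
pose r (b : 'I_(k * n)) := Ordinal (ltn_pmod b k_gt0).
rewrite -[k in (_ <= k)%N]card_ord -(@card_in_imset _ _ r); first exact: max_card.
move=> b c; rewrite !inE !dE => /eqP db /eqP dc /(congr1 val) /= rbc.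
have := ltn_ord_div b; have := ltn_ord_div c => cn bn.
apply/val_inj; rewrite /= (divn_eq b k) (divn_eq c k) rbc; congr (_ * _ + _)%N.
lia.
Qed.

Lemma wrdet_vandermonde_neq0 (F : numFieldType) (n k : nat) :
  wrdet (rect_vandermonde F n k) != 0.
Proof. by rewrite wrdet_vandermonde Dnk_delta_neq0. Qed.

Lemma prod_tnthX (F : fieldType) (N : nat) (lam : N.-tuple nat) (s : 'S_N) :
  \prod_(i < N) 'X_i ^+ tnth lam (s i) =
    'X_[[multinom tnth lam (s i) | i < N]] :> {mpoly F[N]}.
Proof. by rewrite mpolyXE_id; apply: eq_bigr => i _; rewrite mnmE. Qed.

(** Each distinct monomial in the orbit of [lam] is listed once by any transversal,
    and permuting the variables by [w] only permutes these monomials. *)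
Lemma mono_sym_translate (F : fieldType) (N : nat) (lam : N.-tuple nat)
    (X : {set 'S_N}) (w : 'S_N) :
    is_transversal X (stab_cosets lam) [set: 'S_N] ->
  \sum_(s in X) 'X_[[multinom tnth lam (s (w i)) | i < N]] = mono_sym F lam.
Proof.
move=> trX.
pose M (s : 'S_N) : {mpoly F[N]} := 'X_[[multinom tnth lam (s i) | i < N]].
have M_coset s h : h \in part_stab_group lam -> M (s * h)%g = M s.
  rewrite inE => /forallP hh; congr 'X_[_]; apply/mnmP => i.
  by rewrite !mnmE permM (eqP (hh _)).
transitivity (\sum_(s in X) M (w * s)%g).
  apply: eq_bigr => s _; congr 'X_[_]; apply/mnmP => i.
  by rewrite !mnmE permM.
have trT : is_transversal (transversal (stab_cosets lam) [set: 'S_N])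
    (stab_cosets lam) [set: 'S_N].
  by apply: transversalP; case/and3P: trX.
rewrite (sum_transversal_translate _ M_coset trX trT).
by apply: eq_bigr => s _; rewrite prod_tnthX.
Qed.

(** After exchanging the sums over [s] and [w], the sum over [s] with [w] fixed is
    the monomial symmetric function, hence comes out as a common factor. *)
Lemma wrdet_mul_mono_sym (F : fieldType) (n k : nat)
    (lam : (k * n).-tuple nat) (X : {set 'S_(k * n)}) :
    is_transversal X (stab_cosets lam) [set: 'S_(k * n)] ->
  wrdet (rect_vandermonde F n k) * mono_sym F lam =
    \sum_(s in X)
       Dnk F (delta_nk n k + \sum_(i < k * n) (U_(i) *+ tnth lam (s i)))%MM.
Proof.
move=> trX; rewrite wrdet_vandermonde /Dnk kdet_monomials mulr_suml.
under [RHS]eq_bigr => s _ do rewrite kdet_monomials.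
rewrite exchange_big; apply: eq_bigr => w _ /=.
rewrite -(mono_sym_translate _ w^-1%g trX) mulr_sumr.
apply: eq_bigr => s _; rewrite -scalerAl -mpolyXD; congr (_ *: 'X_[_]).
by apply/mnmP => i; rewrite multinom_sumU !(mnmE, mnmDE).
Qed.

(** * The monomial symmetric function as a quotient *)

Theorem lemma6p9 (R : realType) (n k : nat) (hn : (0 < n)%N) (hk : (0 < k)%N)
    (lam : (k * n).-tuple nat) (hlam : sorted geq lam)
    (X : {set 'S_(k * n)})
    (hX : is_transversal X (stab_cosets lam) [set: 'S_(k * n)]) :
  tofrac (mono_sym R[i] lam) =
    (tofrac (wrdet (rect_vandermonde R[i] n k)))^-1 *
    tofrac (\sum_(s in X)
       Dnk R[i]
         (delta_nk n k + \sum_(i < k * n) (U_(i) *+ tnth lam (s i)))%MM)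
    :> {fraction {mpoly R[i][k * n]}}.
Proof.
rewrite -wrdet_mul_mono_sym // rmorphM mulKf // tofrac_eq0.
exact: wrdet_vandermonde_neq0.
Qed.
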